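(* Let $\mathfrak{B}$ be a bornology on a metric space $X$ with a closed base. Let the ideal $\mathcal{I}$ on $\omega$ have a pseudounion. The following statements are equivalent. (1) $X$ has the $\mathcal{I}$-$\mathfrak{B}^s$-Hurewicz property. (2) $X$ has the $\mathfrak{B}^s$-Hurewicz property.
   Context: $(X,d)$ is an infinite metric space; $\omega$ is the set of natural numbers. A bornology $\mathfrak{B}$ on $X$ is a family of subsets of $X$ that is closed under subsets and finite unions and covers $X$. A base of $\mathfrak{B}$ is a subfamily $\mathfrak{B}_0\subseteq\mathfrak{B}$ such that every $B\in\mathfrak{B}$ is contained in some $B_0\in\mathfrak{B}_0$; it is a closed base if its members are closed. For $B\in\mathfrak{B}$, $\delta>0$: $B^\delta=\bigcup_{x\in B}\{y\in X:d(x,y)<\delta\}$. An ideal on $\omega$ is a family $\mathcal{I}\subseteq\mathcal{P}(\omega)$ closed under subsets and finite unions, containing all finite sets, with $\omega\notin\mathcal{I}$. A set $A\subseteq\omega$ is a pseudounion of $\mathcal{I}$ if $\omega\setminus A$ is infinite and $I\setminus A$ is finite for every $I\in\mathcal{I}$. Covers of $X$ never contain $X$ as an element. A cover $\mathcal{U}$ of $X$ by open sets is an open $\mathfrak{B}^s$-cover if for each $B\in\mathfrak{B}$ there are $U\in\mathcal{U}$ and $\delta>0$ with $B^\delta\subseteq U$. $X$ has the $\mathcal{I}$-$\mathfrak{B}^s$-Hurewicz property if for each sequence $\{\mathcal{U}_n:n\in\omega\}$ of open $\mathfrak{B}^s$-covers of $X$ there is a sequence $\{\mathcal{V}_n:n\in\omega\}$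 with $\mathcal{V}_n$ a finite subset of $\mathcal{U}_n$ such that for every $B\in\mathfrak{B}$ there is a sequence $\{\delta_n:n\in\omega\}$ of positive reals with $\{n\in\omega:\text{there is no }U\in\mathcal{V}_n\text{ with }B^{\delta_n}\subseteq U\}\in\mathcal{I}$. $X$ has the $\mathfrak{B}^s$-Hurewicz property if for each sequence $\{\mathcal{U}_n\}$ of open $\mathfrak{B}^s$-covers of $X$ there is a sequence $\{\mathcal{V}_n\}$ with $\mathcal{V}_n$ a finite subset of $\mathcal{U}_n$ such that for every $B\in\mathfrak{B}$ there are $n_0\in\omega$ and positive reals $\delta_n$ ($n\geq n_0$) such that for all $n\geq n_0$, $B^{\delta_n}\subseteq U$ for some $U\in\mathcal{V}_n$. *)

(* Defs.v *)
From mathcomp Require Import all_boot all_order all_algebra.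
From mathcomp Require Import all_classical all_reals all_analysis.

Set Implicit Arguments.
Unset Strict Implicit.
Unset Printing Implicit Defensive.

Import Order.TTheory GRing.Theory Num.Theory.
Local Open Scope classical_set_scope.
Local Open Scope ring_scope.

(* Binary unions suffice: on a nonempty space the empty set is bornological
   because the family covers and is closed under subsets. *)
Definition is_bornology {T : Type} (B : set (set T)) : Prop :=
  [/\ (forall C D : set T, B D -> C `<=` D -> B C),
      (forall C D : set T, B C -> B D -> B (C `|` D))
    & cover B id = [set: T]].

Definition is_base {T : Type} (B B0 : set (set T)) : Prop :=
  B0 `<=` B /\ forall C : set T, B C -> exists2 D : set T, B0 D & C `<=` D.

Definition is_closed_base {X : topologicalType} (B B0 : set (set X)) : Prop :=
  is_base B B0 /\ forall D : set X, B0 D -> closed D.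

Definition enlarge {R : realType} {X : metricType R} (C : set X) (delta : R) :
    set X :=
  \bigcup_(x in C) [set y | mdist x y < delta].

Definition is_ideal (I : set (set nat)) : Prop :=
  [/\ (forall C D : set nat, I D -> C `<=` D -> I C),
      (forall C D : set nat, I C -> I D -> I (C `|` D)),
      (forall C : set nat, finite_set C -> I C)
    & ~ I [set: nat]].

Definition is_pseudounion (I : set (set nat)) (A : set nat) : Prop :=
  infinite_set (~` A) /\ forall J : set nat, I J -> finite_set (J `\` A).

(* A cover never has the whole space as a member. *)
Definition is_cover {T : Type} (U : set (set T)) : Prop :=
  cover U id = [set: T] /\ ~ U [set: T].

Definition open_Bs_cover {R : realType} {X : metricType R}
    (B U : set (set X)) : Prop :=
  [/\ is_cover U,
      (forall O : set X, U O -> open O)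
    & forall C : set X, B C ->
        exists (O : set X) (delta : R),
          [/\ U O, 0 < delta & enlarge C delta `<=` O]].

Definition ideal_Bs_Hurewicz {R : realType} {X : metricType R}
    (I : set (set nat)) (B : set (set X)) : Prop :=
  forall U : nat -> set (set X), (forall n, open_Bs_cover B (U n)) ->
  exists V : nat -> set (set X),
    (forall n, finite_set (V n) /\ V n `<=` U n) /\
    forall C : set X, B C ->
      exists delta : nat -> R,
        (forall n, 0 < delta n) /\
        I [set n | ~ exists2 O : set X, V n O & enlarge C (delta n) `<=` O].

Definition Bs_Hurewicz {R : realType} {X : metricType R}
    (B : set (set X)) : Prop :=
  forall U : nat -> set (set X), (forall n, open_Bs_cover B (U n)) ->
  exists V : nat -> set (set X),
    (forall n, finite_set (V n) /\ V n `<=` U n) /\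
    forall C : set X, B C ->
      exists (n0 : nat) (delta : nat -> R),
        forall n, (n0 <= n)%N ->
          0 < delta n /\
          exists2 O : set X, V n O & enlarge C (delta n) `<=` O.

(* Main.v *)
Require Import Defs.
From mathcomp Require Import all_boot all_order all_algebra.
From mathcomp Require Import all_classical all_reals all_analysis.

(** An ideal contains every finite set, so the Hurewicz property always gives
    its ideal version: the selection fails at finitely many indices only.

    For the converse let [A] be a pseudounion of the ideal and apply the ideal
    property to the covers [common_refinement U n] of all open sets contained in
    a member of each of [U 0], ..., [U n].  The exceptional set of a bornological set
    [C] lies in the ideal, hence is almost contained in [A], so the selection succeeds for
    [C] at almost all indices outside [A].  There are infinitely many of these, so
    each [n] has some [m n >= n] outside [A].  The finite family selected at [m n]
    refines [U n]; replacing its members by supersets in [U n] gives a finite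
    subfamily of [U n] that works for [C] as soon as [n] exceeds the finitely many
    exceptional indices outside [A], because [m n >= n]. *)

Set Implicit Arguments.
Unset Strict Implicit.
Unset Printing Implicit Defensive.

Import Order.TTheory GRing.Theory Num.Theory.
Local Open Scope classical_set_scope.
Local Open Scope ring_scope.

(** Taking every open set that refines the given covers, rather than only the
    intersections of their members, avoids indexing by choices of members. *)
Definition common_refinement {T : topologicalType} (U : nat -> set (set T))
    (n : nat) : set (set T) :=
  [set G | open G /\
           forall i, (i <= n)%N -> exists2 G' : set T, U i G' & G `<=` G'].

Lemma sub_enlarge (R : realType) (X : metricType R) (C : set X) (delta : R) :
  0 < delta -> C `<=` enlarge C delta.
Proof. by move=> delta_gt0 x Cx; exists x => //=; rewrite mdistxx. Qed.

Lemma enlarge_le (R : realType) (X : metricType R) (C : set X) (d e : R) :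
  d <= e -> enlarge C d `<=` enlarge C e.
Proof.
by move=> le_de y [x Cx /= xy]; exists x => //=; apply: lt_le_trans le_de.
Qed.

(** Finitely many covers can be met by one open set: intersect the members
    swallowing an enlargement of [C] and keep the smallest radius. *)
Lemma enlarge_common_refinement (R : realType) (X : metricType R)
    (B : set (set X)) (U : nat -> set (set X)) (C : set X) (n : nat) :
  (forall i, open_Bs_cover B (U i)) -> B C ->
  exists (G : set X) (delta : R),
    [/\ common_refinement U n G, 0 < delta & enlarge C delta `<=` G].
Proof.
move=> covU BC; elim: n => [|n [G [d [[opG refG] d_gt0 CG]]]].
  have [_ opU /(_ C BC) [G [d [UG d_gt0 CG]]]] := covU 0%N.
  exists G, d; split=> //; split; first exact: opU UG.
  by move=> i; rewrite leqn0 => /eqP ->; exists G.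
have [_ opU /(_ C BC) [P [e [UP e_gt0 CP]]]] := covU n.+1.
exists (G `&` P), (Num.min d e); split.
- split; first exact: openI opG (opU _ UP).
  move=> i; rewrite leq_eqVlt => /predU1P [-> | /refG [G' UG' GG']].
    by exists P => // x [].
  by exists G' => // x [/GG'].
- by rewrite lt_min d_gt0.
- move=> x Cx; split.
    by apply/CG/(enlarge_le _ Cx); rewrite ge_min lexx.
  by apply/CP/(enlarge_le _ Cx); rewrite ge_min lexx orbT.
Qed.

(** Points are covered because every bornological set is swallowed; the whole
    space is not a member, since it would then be a member of [U 0]. *)
Lemma common_refinement_cover (R : realType) (X : metricType R)
    (B : set (set X)) (U : nat -> set (set X)) (n : nat) :
  is_bornology B -> (forall i, open_Bs_cover B (U i)) ->
  open_Bs_cover B (common_refinement U n).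
Proof.
move=> [_ _ covB] covU; split; last 2 first.
- by move=> G [].
- by move=> C; apply: enlarge_common_refinement.
split.
  rewrite -subTset => x _.
  have [C BC Cx] : cover B id x by rewrite covB.
  have [G [d [refG d_gt0 CG]]] := enlarge_common_refinement n covU BC.
  by exists G => //; apply/CG/sub_enlarge.
move=> [_ /(_ 0%N (leq0n _)) [G UG]]; rewrite subTset => GT.
by have [[_ +] _ _] := covU 0%N; apply; rewrite -GT.
Qed.

Lemma finite_refinement_lift (T : Type) (V W : set (set T)) :
  finite_set W -> (forall G, W G -> exists2 G', V G' & G `<=` G') ->
  exists V' : set (set T), [/\ finite_set V', V' `<=` V &
    forall G, W G -> exists2 G', V' G' & G `<=` G'].
Proof.
move=> finW refW.
have /choice [f fP] : forall G, exists G', W G -> V G' /\ G `<=` G'.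
  move=> G; have [WG|nWG] := pselect (W G); last by exists set0.
  by have [G' VG' GG'] := refW G WG; exists G'.
exists (f @` W); split; first exact: finite_image.
- by move=> _ [G WG <-]; have [] := fP G WG.
- by move=> G WG; exists (f G); [exists G | have [] := fP G WG].
Qed.

Lemma finite_nat_bounded (S : set nat) :
  finite_set S -> exists n, S `<=` `I_n.
Proof.
move=> /finite_seqP [s ->]; exists (\max_(i <- s) i).+1 => i /= si.
by rewrite ltnS (leq_bigmax_seq (F := fun j : nat => j) i si).
Qed.

Lemma infinite_nat_unbounded (S : set nat) (n : nat) :
  infinite_set S -> exists2 k, (n <= k)%N & S k.
Proof.
move=> infS; apply: contrapT => nS; apply: infS.
apply: sub_finite_set (finite_II n) => k Sk /=.
by rewrite ltnNge; apply/negP => le_nk; apply: nS; exists k.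
Qed.

(** The same selection works: its failures for a given set all lie below [n0]. *)
Lemma Bs_Hurewicz_ideal (R : realType) (X : metricType R)
    (B : set (set X)) (I : set (set nat)) :
  is_ideal I -> Bs_Hurewicz B -> ideal_Bs_Hurewicz I B.
Proof.
move=> [subI _ finI _] hurB U covU.
have [V [VU VP]] := hurB U covU; exists V; split=> // C BC.
have [n0 [d dP]] := VP C BC.
(* the radii below [n0] may be arbitrary, but must be positive *)
exists (fun n => if (n0 <= n)%N then d n else 1); split.
  by move=> n; case: ifP => // /dP [].
apply: (subI _ `I_n0); first exact/finI/finite_II.
move=> n /= bad; rewrite ltnNge; apply/negP => le_n0n.
by apply: bad; rewrite le_n0n; have [] := dP n le_n0n.
Qed.

(** A selection for the common refinements that is good at an index [k >= n]
    is good for [U n]; this lets the good indices outside [A] serve all large [n]. *)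
Lemma ideal_Bs_Hurewicz_pseudounion (R : realType) (X : metricType R)
    (B : set (set X)) (I : set (set nat)) (A : set nat) :
  is_bornology B -> is_pseudounion I A ->
  ideal_Bs_Hurewicz I B -> Bs_Hurewicz B.
Proof.
move=> bornB [infA pseudoA] hurB U covU.
have [W [WU WP]] :=
  hurB _ (fun n => common_refinement_cover n bornB covU).
have /choice [m mP] : forall n, exists k, (n <= k)%N /\ ~ A k.
  by move=> n; have [k ? ?] := infinite_nat_unbounded n infA; exists k.
have /choice [V VP] : forall n, exists V', [/\ finite_set V', V' `<=` U n &
    forall G, W (m n) G -> exists2 G', V' G' & G `<=` G'].
  (* as [n <= m n], every set selected at [m n] lies in a member of [U n] *)
  move=> n; have [finW subW] := WU (m n).
  apply: finite_refinement_lift finW _ => G /subW [_ refG].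
  by apply: refG; have [] := mP n.
exists V; split; first by move=> n; have [] := VP n.
move=> C BC; have [d [d_gt0 /pseudoA fin_bad]] := WP C BC.
have [n0 sub_bad] := finite_nat_bounded fin_bad.
have n0P k : (n0 <= k)%N -> ~ A k ->
    exists2 G : set X, W k G & enlarge C (d k) `<=` G.
  move=> le_n0k nAk; apply: contrapT => bad.
  by have /= := sub_bad k (conj bad nAk); rewrite ltnNge le_n0k.
exists n0, (d \o m) => n le_n0n; split; first exact: d_gt0.
have [le_nm nAm] := mP n; have [_ _ liftV] := VP n.
have [G WG CG] := n0P _ (leq_trans le_n0n le_nm) nAm.
have [G' VG' GG'] := liftV G WG.
by exists G' => //; apply: subset_trans GG'.
Qed.

Theorem theorem4p3 (R : realType) (X : metricType R)
    (X_infinite : infinite_set [set: X])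
    (B : set (set X)) (B_bornology : is_bornology B)
    (B_closed_base : exists B0 : set (set X), is_closed_base B B0)
    (I : set (set nat)) (I_ideal : is_ideal I)
    (I_pseudounion : exists A : set nat, is_pseudounion I A) :
  ideal_Bs_Hurewicz I B <-> Bs_Hurewicz B.
Proof.
split; last exact: Bs_Hurewicz_ideal.
by have [A psA] := I_pseudounion; apply: ideal_Bs_Hurewicz_pseudounion psA.
Qed.
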